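(* Let $m$ be a positive integer and let $\wp$ be an odd prime such that $3$ is a primitive root modulo $\wp^m$. Let $q=3^{\phi(\wp^m)}$ and $$D=\{x\in\mathbb{F}_q^*:\ {\rm Tr}(x^{\frac{q-1}{\wp^m}})=0\}.$$ Then the following statements on the code $\mathcal{C}_D$ are true. (a) If $\wp\equiv 1\pmod 3$, then $\mathcal{C}_D$ is an $\left[\frac{(q-1)(\wp^m-\wp+1)}{\wp^m},\ (\wp-1)\wp^{m-1}\right]$ ternary code having two weights $$w_1=\frac{2(\wp^m-\wp+1)q}{3\wp^m}-\frac{2(\wp-1)\sqrt{q}}{3\wp^m},\qquad w_2=\frac{2(\wp^m-\wp+1)q}{3\wp^m}+\frac{2(\wp^m-\wp+1)\sqrt{q}}{3\wp^m},$$ with $$A_{w_1}=\frac{(\wp^m-\wp+1)(q-1)}{\wp^m},\qquad A_{w_2}=\frac{(\wp-1)(q-1)}{\wp^m}.$$ (b) If $\wp\equiv -1\pmod 3$ and $m\ge 2$, then $\mathcal{C}_D$ is an $\left[\frac{(q-1)(\wp^{m-1}-1)}{\wp^{m-1}},\ (\wp-1)\wp^{m-1}\right]$ ternary code having two weights $$w_1=\frac{2(\wp^{m-1}-1)q}{3\wp^{m-1}}+\frac{2(\wp^{m-1}-1)\sqrt{q}}{3\wp^{m-1}},\qquad w_2=\frac{2(\wp^{m-1}-1)q}{3\wp^{m-1}}-\frac{2\sqrt{q}}{3\wp^{m-1}},$$ with $$A_{w_1}=\frac{q-1}{\wp^{m-1}},\qquad A_{w_2}=\frac{(\wp^{m-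1}-1)(q-1)}{\wp^{m-1}}.$$
   Context: $\phi$ is Euler's totient function and ${\rm Tr}$ is the trace from $\mathbb{F}_q$ onto $\mathbb{F}_3$. For $D=\{d_1,\ldots,d_n\}\subseteq\mathbb{F}_q^*$ (with $n=\#D$), the linear code over $\mathbb{F}_3$ with defining set $D$ is $$\mathcal{C}_D=\{({\rm Tr}(d_1x),{\rm Tr}(d_2x),\ldots,{\rm Tr}(d_nx)):\ x\in\mathbb{F}_q\}\subseteq\mathbb{F}_3^n.$$ An $[n,k]$ ternary code is a $k$-dimensional linear subspace of $\mathbb{F}_3^n$. $A_w$ denotes the number of codewords of Hamming weight $w$. ''Having two weights $w_1,w_2$'' means that the nonzero codewords have Hamming weights exactly $w_1$ and $w_2$. *)

(* Defs.v *)
From mathcomp Require Import all_boot all_order all_algebra all_fingroup all_field.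

Set Implicit Arguments.
Unset Strict Implicit.
Unset Printing Implicit Defensive.

Import GRing.Theory.
Local Open Scope ring_scope.

(* The multiplicative order of g modulo n is totient n; to be used for n > 1
   only, as 'Z_n is the ring of integers modulo n only for n > 1.           *)
Definition primitive_root_mod (g n : nat) : Prop :=
  (totient n).-primitive_root (g%:R : 'Z_n).

Section TernaryTrace.

Variables (F : finFieldType) (char3 : 3%N \in [pchar F]).

(* pPrimeCharType char3 is the carrier of F with its canonical structure of
   Galois extension of 'F_3.  galTrace takes its values in the extension
   itself; Tr reads them in 'F_3, along the embedding a |-> a%:A. The default
   value of odflt is never used, by Tr_galTrace.                             *)
Definition Tr (x : F) : 'F_3 :=
  odflt 0 [pick a : 'F_3 |
    a%:A == galTrace 1 {:pPrimeCharType char3} (x : pPrimeCharType char3)].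

Lemma Tr_galTrace (x : F) :
  (Tr x)%:A = galTrace 1 {:pPrimeCharType char3} (x : pPrimeCharType char3).
Proof.
rewrite /Tr; case: pickP => [a /eqP // | no_a].
pose L := pPrimeCharType char3.
have galL : galois 1%AS {:L} by exact: finField_galois (sub1v _).
have /vlineP[a tr_a] := mem_galTrace galL (memvf (x : L)).
by have := no_a a; rewrite tr_a eqxx.
Qed.

(* The code with defining set {d_1, ..., d_n}, listed in the order of d. *)
Definition defining_set_code (n : nat) (d : n.-tuple F) : {set 'rV['F_3]_n} :=
  [set \row_(j < n) Tr (tnth d j * x) | x : F].

End TernaryTrace.

Section TernaryCodes.

Variable n : nat.
Implicit Types (c : 'rV['F_3]_n) (C : {set 'rV['F_3]_n}).

Definition hamming_weight c : nat := #|[set j | c 0 j != 0]|.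

Definition linear_code_of_dim (k : nat) C : Prop :=
  exists2 V : {vspace 'rV['F_3]_n}, C =i V & \dim V = k.

(* Weights are elements of R, so that they can be given by formulas
   involving quotients and square roots.                            *)
Definition weight_count (R : rcfType) C (w : R) : nat :=
  #|[set c in C | (hamming_weight c)%:R == w]|.

Definition has_two_weights (R : rcfType) C (w1 w2 : R) : Prop :=
  forall w : R,
    (exists c, [/\ c \in C, c != 0 & (hamming_weight c)%:R = w]) <->
    (w = w1 \/ w = w2).

End TernaryCodes.

(* Main.v *)
Require Import Defs.
From HB Require Import structures.
From mathcomp Require Import all_boot all_order all_algebra all_fingroup all_field.
From mathcomp Require Import cyclic zify ring lra.

Set Implicit Arguments.
Unset Strict Implicit.
Unset Printing Implicit Defensive.

Import Order.TTheory GRing.Theory Num.Theory.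
Local Open Scope ring_scope.

(** The set D is a union of lines of F, seen as a plane over its subfield K of
    order s = 3^h, where q = s^2, and this is what makes the weights computable.

    As 3 is a primitive root modulo N = p^m, its power s is congruent to -1
    modulo N (dvdn_primitive_root_half), so s + 1 = k N, with k even because
    s + 1 is even and N odd.  Hence (q - 1) / N = (s - 1) k, and membership of x
    in D depends only on x^(s-1), that is, on the line K x.

    For b != 0 the trace of F, composed with multiplication by b, restricts to
    the line K x as t |-> tr_K (t v) with v = bx + (bx)^s.  If v != 0, it is
    nonzero at exactly 2s/3 points of the line; v = 0 happens on a single line,
    given by (bx)^(s-1) = -1.  So the codeword of b has weight 2s/3 times the
    number of lines of D, minus 2s/3 if the exceptional line lies in D
    (trace_weightE).  On this line (bx)^((s-1)k) = (-1)^k = 1, so x^((s-1)k) is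
    the inverse of b^((s-1)k); as the condition defining D does not distinguish
    an N-th root of unity from its inverse, the exceptional line of b lies in D
    if and only if b does (line_union_dual).  The weights, and their
    multiplicities #D and q - 1 - #D, follow (two_weight_code).

    It remains to find #D.  The conjugates of an N-th root of unity z are its
    powers z^(3^i), and 3^i runs through the units modulo N, so that
    Tr z = N [z = 1] - (N / p) [z^p = 1] (sum_primitive_root_powers and
    sum_coprime_powers).  Modulo 3 this vanishes if and only if z = 1 or
    z^p != 1 when p = 1 modulo 3, and if and only if z^p != 1 when p = 2
    modulo 3.  Both sets are counted with the roots of unity of F. *)

(** * Roots of 1 and -1 in a finite field *)

Lemma neq0_expr_eq (F : fieldType) (k : nat) (x c : F) :
  (0 < k)%N -> c != 0 -> x ^+ k = c -> x != 0.
Proof. by move=> k_gt0 + xk; rewrite -xk expf_eq0 k_gt0. Qed.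

Lemma card_expr_eq1 (F : finFieldType) (k : nat) :
  (0 < k)%N -> (k %| #|F|.-1)%N -> #|[set x : F | x ^+ k == 1]| = k.
Proof.
move=> k_gt0 k_dvd.
have F_gt1 := finNzRing_gt1 F.
have q1_gt0 : (0 < #|F|.-1)%N by rewrite -ltnS prednK // ltnW.
have : has #|F|.-1.-primitive_root [seq x <- enum F | x != 0].
  apply: has_prim_root => //.
  - apply/allP => x; rewrite mem_filter => /andP[x_neq0 _].
    apply/unity_rootP/(mulfI x_neq0).
    by rewrite mulr1 -exprS prednK ?expf_card // ltnW.
  - by rewrite filter_uniq ?enum_uniq.
  - by rewrite -(cardC1 (0 : F)) cardE enumT; apply: eq_leq; congr size; apply: eq_filter.
case/hasP => g _ g_prim.
have z_prim := dvdn_prim_root g_prim k_dvd.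
set z := g ^+ _ in z_prim.
rewrite -[RHS]card_ord -(card_imset (f := fun i : 'I_k => z ^+ i)); last first.
  move=> i j /eqP; rewrite (eq_prim_root_expr z_prim) !modn_small //.
  by move=> /eqP/val_inj.
apply: eq_card => x; rewrite inE; apply/eqP/imsetP => [xk1|[i _ ->]].
  by have [i ->] := prim_rootP z_prim xk1; exists i.
by rewrite -exprM mulnC exprM (prim_expr_order z_prim) expr1n.
Qed.

(** The 2k-th roots of unity are the k-th roots of 1 and those of -1. *)
Lemma card_expr_eqN1 (F : finFieldType) (k : nat) :
  (0 < k)%N -> (2 * k %| #|F|.-1)%N -> (2%:R != 0 :> F) ->
  #|[set x : F | x ^+ k == -1]| = k.
Proof.
move=> k_gt0 k2_dvd two_neq0.
have := card_expr_eq1 _ k2_dvd; rewrite muln_gt0 k_gt0 => /(_ isT).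
have -> : [set x : F | x ^+ (2 * k) == 1]
    = [set x : F | x ^+ k == 1] :|: [set x : F | x ^+ k == -1].
  apply/setP => x; rewrite !inE mulnC exprM -subr_eq0.
  by rewrite subr_sqr_1 mulf_eq0 subr_eq0 addr_eq0.
rewrite cardsU card_expr_eq1 //; last by apply: dvdn_trans k2_dvd; rewrite dvdn_mull.
have -> : [set x : F | x ^+ k == 1] :&: [set x : F | x ^+ k == -1] = set0.
  apply/setP => x; rewrite !inE; apply/negP => /andP[/eqP ->].
  by rewrite -addr_eq0 (negbTE two_neq0).
by rewrite cards0; lia.
Qed.

Lemma card_roots_le (F : finFieldType) (P : {poly F}) (d : nat) :
  P != 0 -> (size P <= d.+1)%N -> (#|[set t | root P t]| <= d)%N.
Proof.
move=> P_neq0 szP; rewrite -ltnS; apply: leq_trans szP; rewrite cardE.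
apply: max_poly_roots => //; last exact: enum_uniq.
by apply/allP => t; rewrite mem_enum inE.
Qed.

Lemma three_expn_gt1 (h : nat) : (1 < 3 ^ h.+1)%N.
Proof. by rewrite -[1%N](expn0 3) ltn_exp2l. Qed.

(** * Trace values on a line over a subfield *)

Section Frobenius.

Variables (F : finFieldType) (char3 : 3%N \in [pchar F]).

(** On the subfield of order 3 ^ h, this is the trace onto the prime field; it is
    computed in F, so that traces of F and of its subfields can be compared. *)
Definition frobenius_sum (h : nat) (x : F) : F := \sum_(i < h) x ^+ (3 ^ i).

Lemma expr3D (i : nat) : {morph (fun x : F => x ^+ (3 ^ i)) : x y / x + y}.
Proof.
by move=> x y; rewrite exprDn_pchar // (eq_pnat _ (pcharf_eq char3)) pnatX pnat_id.
Qed.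

Lemma two_neq0_char3 : 2%:R != 0 :> F.
Proof. by rewrite -(dvdn_pcharf char3). Qed.

(** The prime field consists of the roots of the polynomial X^3 - X. *)
Lemma cube_eqE (x : F) : x ^+ 3 = x -> [|| x == 0, x == 1 | x == -1].
Proof.
move=> x3; have : x * ((x - 1) * (x + 1)) == 0.
  by rewrite -subr_sqr_1 mulrBr mulr1 -exprS x3 subrr.
by rewrite !mulf_eq0 subr_eq0 addr_eq0.
Qed.

(** Cubing permutes the terms of the sum cyclically. *)
Lemma frobenius_sum_cube (h : nat) (x : F) :
  x ^+ (3 ^ h) = x -> frobenius_sum h x ^+ 3 = frobenius_sum h x.
Proof.
move=> xK; rewrite /frobenius_sum.
rewrite (big_morph (fun x : F => x ^+ 3) (expr3D 1) (expr0n _ 3)).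
case: h xK => [|h] xK; first by rewrite !big_ord0.
rewrite big_ord_recr [RHS]big_ord_recl /= -exprM -expnSr xK addrC.
by congr (_ + _); apply: eq_bigr => i _; rewrite -exprM -expnSr.
Qed.

(** The left-hand side is a polynomial in t of degree at most 3 ^ h; it is not
    constant because the coefficient of its term of degree 1 is v. *)
Lemma card_frobenius_sum_eq_le (h : nat) (v c : F) : v != 0 ->
  (#|[set t : F | (frobenius_sum h.+1 (v * t) == c)%R]| <= 3 ^ h)%N.
Proof.
move=> v_neq0.
pose P := \sum_(i < h.+1) (v ^+ (3 ^ i)) *: 'X^(3 ^ i) - c%:P : {poly F}.
have P1 : P`_1 = v.
  rewrite coefB coefC subr0 coef_sum (bigD1 ord0) //= coefZ coefXn mulr1.
  rewrite big1 ?addr0 // => i i_neq0; rewrite coefZ coefXn.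
  rewrite (_ : (1 == 3 ^ i) = (i == 0 :> nat))%N; last first.
    by rewrite -(eqn_exp2l i 0 (m := 3)) // eq_sym.
  by move: i_neq0; rewrite -val_eqE /= => /negbTE ->; rewrite mulr0.
have P_neq0 : P != 0 by apply: contraNneq v_neq0 => P0; rewrite -P1 P0 coef0.
have szP : (size P <= (3 ^ h).+1)%N.
  apply: leq_trans (size_polyD _ _) _; rewrite geq_max size_polyN.
  rewrite (leq_trans (size_polyC_leq1 _)) // andbT.
  apply: leq_trans (size_sum _ _ _) _; apply/bigmax_leqP => i _.
  apply: leq_trans (size_scale_leq _ _) _.
  by rewrite size_polyXn ltnS leq_pexp2l // -ltnS.
apply: leq_trans (card_roots_le P_neq0 szP); apply: subset_leq_card.
apply/subsetP => t; rewrite !inE rootE !hornerE horner_sum subr_eq0.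
by under [X in _ -> X == _]eq_bigr => i _ do rewrite !hornerE -exprMn.
Qed.

(** The trace of the subfield of order s takes only the values 0, 1, -1, each at
    most s / 3 times by card_frobenius_sum_eq_le; as there are s points in all,
    each value is taken exactly s / 3 times. *)
Lemma card_frobenius_sum_neq0 (h : nat) (v : F) :
  v != 0 -> v ^+ (3 ^ h.+1) = v -> ((3 ^ h.+1).-1 %| #|F|.-1)%N ->
  #|[set t : F | (t ^+ (3 ^ h.+1).-1 == 1)
       && (frobenius_sum h.+1 (v * t) != 0)]| = (2 * 3 ^ h)%N.
Proof.
set s := (3 ^ h.+1)%N => v_neq0 vK s_dvd.
have s_gt1 : (1 < s)%N := three_expn_gt1 h.
pose U := [set t : F | t ^+ s.-1 == 1].
have cardU : #|U| = s.-1 by apply: card_expr_eq1 => //; lia.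
pose Z c := [set t : F | frobenius_sum h.+1 (v * t) == c].
have cardZ c : (#|Z c| <= 3 ^ h)%N by exact: card_frobenius_sum_eq_le.
set A := [set t | _].
have A_sub : A \subset Z 1 :|: Z (-1).
  apply/subsetP => t; rewrite !inE => /andP[/eqP tU g_neq0].
  have tK : (v * t) ^+ s = v * t.
    by rewrite exprMn vK -{1}(prednK (ltnW s_gt1)) exprS tU mulr1.
  by have := cube_eqE (frobenius_sum_cube tK); rewrite (negbTE g_neq0).
have K_sub : 0 |: U \subset A :|: Z 0.
  apply/subsetP => t; rewrite !inE => /predU1P[->|->]; last first.
    by rewrite /=; case: eqP; rewrite ?orbT.
  rewrite mulr0 /frobenius_sum big1 ?eqxx ?orbT // => i _.
  by rewrite expr0n expn_eq0.
have := subset_leq_card A_sub; have := subset_leq_card K_sub.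
have -> : #|0 |: U| = s.
  rewrite cardsU1 cardU inE expr0n.
  by case: (s) s_gt1 => [|[]] //= ? _; rewrite eq_sym oner_eq0.
have := cardZ 0; have := cardZ 1; have := cardZ (-1).
have [] := (leq_card_setU A (Z 0), leq_card_setU (Z 1) (Z (-1))).
move: #|_ :|: _| #|Z 1 :|: _| => a b [/= + _] [/= + _].
have : s = (3 * 3 ^ h)%N by rewrite /s expnS.
clearbody s; clear; move: #|A| #|Z 0| #|Z 1| #|Z (-1)| (3 ^ h)%N; lia.
Qed.

(** Transitivity of the trace from F through its subfield of order 3 ^ h: the
    factor y + y ^+ (3 ^ h) is the relative trace of y. *)
Lemma frobenius_sum_relative (h : nat) (y t : F) : t ^+ (3 ^ h) = t ->
  frobenius_sum (h + h) (y * t) = frobenius_sum h ((y + y ^+ (3 ^ h)) * t).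
Proof.
move=> tK; rewrite /frobenius_sum big_split_ord /= -big_split /=.
apply: eq_bigr => i _; rewrite mulrDl expr3D; congr (_ + _).
by rewrite expnD exprM exprMn tK.
Qed.

(** The points y t, with t as in the set below, are the nonzero points of the line
    through y over the subfield; the line is in the kernel of the trace exactly
    when the relative trace y + y ^+ (3 ^ h.+1) vanishes. *)
Lemma card_line_trace_neq0 (h : nat) (y : F) : #|F| = (3 ^ (h.+1 + h.+1))%N ->
  y != 0 ->
  #|[set t : F | (t ^+ (3 ^ h.+1).-1 == 1)
       && (frobenius_sum (h.+1 + h.+1) (y * t) != 0)]|
  = if y ^+ (3 ^ h.+1).-1 == -1 then 0%N else (2 * 3 ^ h)%N.
Proof.
move=> cardF y_neq0; set s := (3 ^ h.+1)%N.
have s_gt0 : (0 < s)%N by rewrite expn_gt0.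
set v := y + y ^+ s.
have v0E : (v == 0) = (y ^+ s.-1 == -1).
  rewrite /v -(prednK s_gt0) exprS -{1}(mulr1 y) -mulrDr mulf_eq0.
  by rewrite (negbTE y_neq0) addrC addr_eq0.
have -> : [set t | (t ^+ s.-1 == 1) && (frobenius_sum (h.+1 + h.+1) (y * t) != 0)]
   = [set t | (t ^+ s.-1 == 1) && (frobenius_sum h.+1 (v * t) != 0)].
  apply/setP => t; rewrite !inE; apply: andb_id2l => /eqP tU.
  by rewrite frobenius_sum_relative // -/s -(prednK s_gt0) exprS tU mulr1.
rewrite -v0E; case: eqP => [->|/eqP v_neq0].
  apply/eqP; rewrite cards_eq0; apply/eqP/setP => t; rewrite !inE mul0r.
  rewrite /frobenius_sum big1 ?eqxx ?andbF // => i _.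
  by rewrite expr0n expn_eq0.
apply: card_frobenius_sum_neq0 => //.
  by rewrite /v expr3D -exprM -expnD -cardF expf_card addrC.
by rewrite cardF expnD -/s; apply/dvdnP; exists s.+1; nia.
Qed.

End Frobenius.

(** * Primitive roots modulo a prime power *)

Lemma eq_Zp_nat (N x y : nat) : (1 < N)%N ->
  (x%:R == y%:R :> 'Z_N) = (x == y %[mod N]).
Proof. by move=> N_gt1; rewrite -val_eqE /= !val_Zp_nat. Qed.

Lemma primitive_root_coprime (g N : nat) :
  (1 < N)%N -> primitive_root_mod g N -> coprime N g.
Proof.
move=> N_gt1 g_prim; have N_gt0 := ltnW N_gt1.
rewrite -unitZpE // -(@unitrX_pos _ _ (totient N)) ?totient_gt0 //.
by rewrite (prim_expr_order g_prim) unitr1.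
Qed.

(** The powers of g run once through the units modulo N. *)
Lemma sum_primitive_root_powers (R : nzRingType) (g N : nat) (z : R) :
  (1 < N)%N -> primitive_root_mod g N -> z ^+ N = 1 ->
  \sum_(i < totient N) z ^+ (g ^ i) = \sum_(k < N | coprime N k) z ^+ k.
Proof.
move=> N_gt1 g_prim zN; have N_gt0 := ltnW N_gt1.
have g_unit := primitive_root_coprime N_gt1 g_prim.
pose f (i : 'I_(totient N)) : 'I_N := Ordinal (ltn_pmod (g ^ i) N_gt0).
have f_inj : injective f.
  move=> i j /(congr1 val)/= /eqP; rewrite -eq_Zp_nat // !natrX.
  rewrite (eq_prim_root_expr g_prim) !modn_small //.
  by move=> /eqP/val_inj.
have im_f : f @: 'I_(totient N) = [set k : 'I_N | coprime N k].
  apply/eqP; rewrite eqEcard card_imset // card_ord; apply/andP; split.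
    by apply/subsetP => _ /imsetP[i _ ->]; rewrite inE /= coprime_modr coprimeXr.
  by rewrite cardsE totient_count_coprime big_mkord -sum1_card big_mkcond.
have im_fE (k : 'I_N) : coprime N k = (k \in f @: 'I_(totient N)) by rewrite im_f inE.
rewrite (eq_bigl _ _ im_fE) big_imset /=; last by move=> i j _ _ /f_inj.
by apply: eq_bigr => i _; rewrite expr_mod.
Qed.

Lemma sum_expr_unity (R : idomainType) (n : nat) (x : R) : x ^+ n = 1 ->
  \sum_(i < n) x ^+ i = if x == 1 then n%:R else 0.
Proof.
move=> xn; case: eqP => [->|/eqP x_neq1].
  by under eq_bigr do rewrite expr1n; rewrite sumr_const card_ord.
apply: (@mulfI _ (x - 1)); first by rewrite subr_eq0.
by rewrite -subrX1 xn subrr mulr0.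
Qed.

(** The sum over all k is a geometric sum with ratio z, and the terms to be removed,
    those with k divisible by p, form a geometric sum with ratio z ^+ p. *)
Lemma sum_coprime_powers (R : idomainType) (p m : nat) (z : R) :
  prime p -> z ^+ (p ^ m.+1) = 1 ->
  \sum_(k < p ^ m.+1 | coprime (p ^ m.+1) k) z ^+ k
  = (if z == 1 then (p ^ m.+1)%:R else 0) - (if z ^+ p == 1 then (p ^ m)%:R else 0).
Proof.
move=> p_prime; rewrite expnS; set M := (p ^ m)%N => zN.
have p_gt0 := prime_gt0 p_prime.
rewrite -(sum_expr_unity zN) -sum_expr_unity ?exprM -?exprM //.
rewrite [X in X - _](bigID (fun k : 'I_(p * M) => coprime (p * M) k)) /=.
rewrite -[LHS]addr0 -addrA; congr (_ + _); apply/esym/eqP; rewrite subr_eq0; apply/eqP.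
have ltm (j : 'I_M) : (p * j < p * M)%N by rewrite ltn_pmul2l.
have ltd (k : 'I_(p * M)) : (k %/ p < M)%N.
  by rewrite ltn_divLR // (leq_trans (ltn_ord k)) // mulnC.
rewrite (reindex_onto (fun j => Ordinal (ltm j)) (fun k => Ordinal (ltd k))) /=.
  apply: eq_big => [j|j _]; last by rewrite exprM.
  rewrite -val_eqE /= mulKn // eqxx andbT.
  by rewrite coprimeMl prime_coprime // dvdn_mulr.
move=> k k_ncoprime; have p_dvd : (p %| k)%N.
  apply: contraNT k_ncoprime => p_ndvd.
  by rewrite coprimeMl coprimeXl ?prime_coprime ?p_ndvd.
by apply: val_inj; rewrite /= mulnC divnK.
Qed.

(** The half power of a primitive root is -1: p ^ m.+1 divides the product of
    g ^ h - 1 and g ^ h + 1, of which p can divide only one, as their difference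
    is 2; and it does not divide g ^ h - 1, because g has order h + h. *)
Lemma dvdn_primitive_root_half (g p m h : nat) : prime p -> odd p ->
  primitive_root_mod g (p ^ m.+1) -> totient (p ^ m.+1) = (h + h)%N ->
  (p ^ m.+1 %| (g ^ h).+1)%N.
Proof.
move=> p_prime p_odd g_prim tot.
have p_gt1 := prime_gt1 p_prime.
have N_gt1 : (1 < p ^ m.+1)%N by rewrite -[1%N](expn0 p) ltn_exp2l.
have h_gt0 : (0 < h)%N.
  by have := totient_gt0 (p ^ m.+1); rewrite tot (ltnW N_gt1); lia.
have g_coprime := primitive_root_coprime N_gt1 g_prim.
have g_gt0 : (0 < g)%N.
  by case: (g) g_coprime; rewrite // /coprime gcdn0 => /eqP N1; rewrite N1 in N_gt1.
have gh_gt0 : (0 < g ^ h)%N by rewrite expn_gt0 g_gt0.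
have gX k : (p ^ m.+1 %| g ^ k - 1)%N = (h + h %| k)%N.
  have := eq_prim_root_expr g_prim k 0; rewrite tot -!natrX eq_Zp_nat //.
  by rewrite eqn_mod_dvd ?expn_gt0 ?g_gt0 // expn0 mod0n => ->.
have N_dvd : (p ^ m.+1 %| (g ^ h - 1) * (g ^ h).+1)%N.
  have -> : ((g ^ h - 1) * (g ^ h).+1 = g ^ (h + h) - 1)%N.
    by rewrite expnD; nia.
  by rewrite gX.
have [p_dvd|p_ndvd] := boolP (p %| g ^ h - 1)%N; last first.
  by move: N_dvd; rewrite Gauss_dvdr // coprimeXl // prime_coprime.
have p_ndvd : ~~ (p %| (g ^ h).+1)%N.
  apply/negP => p_dvd2; have : (p %| 2)%N.
    have -> : (2 = (g ^ h).+1 - (g ^ h - 1))%N by move: gh_gt0; clear; lia.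
    exact: dvdn_sub.
  by rewrite dvdn_prime2 // => /eqP p2; rewrite p2 in p_odd.
move: N_dvd; rewrite Gauss_dvdl ?coprimeXl ?prime_coprime // gX.
by move/(dvdn_leq h_gt0); lia.
Qed.

(** * The trace of a root of unity *)

Section TraceFormula.

Variables (F : finFieldType) (char3 : 3%N \in [pchar F]).
Local Notation L := (pPrimeCharType char3).

(** The Galois group is cyclic, generated by x |-> x ^+ 3. *)
Lemma galTrace_frobenius_sum (f : nat) (x : L) : #|F| = (3 ^ f)%N ->
  galTrace 1 {:L} x = frobenius_sum f (x : F).
Proof.
move=> cardF.
have [alpha gen_alpha alphaE] := finField_galois_generator (sub1v {:L}).
have {}alphaE y : alpha y = y ^+ 3.
  by rewrite alphaE ?memvf //= dimv1 expn1 card_Fp.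
have dimL : \dim {:L} = f.
  have := card_vspacef (Vector.class L); rewrite card_vspace card_Fp // [RHS]cardF.
  by move/eqP; rewrite eqn_exp2l // => /eqP.
have galL : galois 1%AS {:L} by exact: finField_galois (sub1v _).
have ord_alpha : #[alpha]%g = f.
  by rewrite orderE -(eqP gen_alpha) -(galois_dim galL) dimv1 divn1.
have alphaX i (y : L) : (alpha ^+ i)%g y = y ^+ (3 ^ i).
  elim: i => [|i IHi]; first by rewrite expg0 gal_id.
  by rewrite expgSr galM ?memvf // IHi alphaE expnSr exprM.
rewrite /galTrace (eqP gen_alpha) /frobenius_sum -ord_alpha.
have cycleE : <[alpha]>%g = (fun i : 'I_#[alpha]%g => (alpha ^+ i)%g) @: 'I_#[alpha]%g.
  apply/setP => y; apply/idP/imsetP => [/cyclePmin[i i_lt ->]|[i _ ->]].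
    by exists (Ordinal i_lt).
  exact: mem_cycle.
rewrite cycleE big_imset /=; first by apply: eq_bigr => i _; exact: alphaX.
by move=> i j _ _ /eqP; rewrite eq_expg_ord // => /eqP.
Qed.

Lemma Tr_eq0 (f : nat) (x : F) : #|F| = (3 ^ f)%N ->
  (Tr char3 x == 0) = (frobenius_sum f x == 0).
Proof.
move=> cardF; rewrite -(galTrace_frobenius_sum x cardF) -Tr_galTrace.
by rewrite -[RHS]/((Tr char3 x)%:A == 0 :> L) scaler_eq0 oner_eq0 orbF.
Qed.

Lemma TrB : {morph Tr char3 : x y / x - y}.
Proof.
move=> x y; apply: (fmorph_inj (GRing.in_alg L)).
by rewrite rmorphB /= !Tr_galTrace raddfB.
Qed.

End TraceFormula.

Lemma natr_mod3 (F : finFieldType) (p : nat) : 3%N \in [pchar F] ->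
  p%:R = (p %% 3)%:R :> F.
Proof.
by move=> char3; rewrite {1}(divn_eq p 3) natrD natrM (pcharf0 char3) mulr0 add0r.
Qed.

Lemma Tr_unity_root (F : finFieldType) (char3 : 3%N \in [pchar F]) (p m : nat) (z : F) :
  prime p -> primitive_root_mod 3 (p ^ m.+1) -> #|F| = (3 ^ totient (p ^ m.+1))%N ->
  z ^+ (p ^ m.+1) = 1 ->
  (Tr char3 z == 0) = ((if z == 1 then (p ^ m.+1)%:R else 0)
                        == (if z ^+ p == 1 then (p ^ m)%:R else 0) :> F).
Proof.
move=> p_prime prim3 cardF zN; rewrite (Tr_eq0 _ _ cardF) /frobenius_sum.
rewrite sum_primitive_root_powers ?sum_coprime_powers ?subr_eq0 //.
by rewrite -[1%N](expn0 p) ltn_exp2l // prime_gt1.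
Qed.

Lemma Tr_unity_root_mod1 (F : finFieldType) (char3 : 3%N \in [pchar F]) (p m : nat) (z : F) :
  prime p -> primitive_root_mod 3 (p ^ m.+1) -> #|F| = (3 ^ totient (p ^ m.+1))%N ->
  z ^+ (p ^ m.+1) = 1 -> p = 1 %[mod 3] ->
  (Tr char3 z == 0) = (z == 1) || (z ^+ p != 1).
Proof.
move=> p_prime prim3 cardF zN p1; rewrite (Tr_unity_root _ p_prime prim3) //.
rewrite !natrX (natr_mod3 p char3) p1 !expr1n.
have [->|] := eqVneq z 1; first by rewrite expr1n !eqxx.
by move=> _; case: ifP => _; rewrite ?eqxx // eq_sym oner_eq0.
Qed.

Lemma Tr_unity_root_mod2 (F : finFieldType) (char3 : 3%N \in [pchar F]) (p m : nat) (z : F) :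
  prime p -> primitive_root_mod 3 (p ^ m.+1) -> #|F| = (3 ^ totient (p ^ m.+1))%N ->
  z ^+ (p ^ m.+1) = 1 -> p = 2 %[mod 3] ->
  (Tr char3 z == 0) = (z ^+ p != 1).
Proof.
move=> p_prime prim3 cardF zN p2; rewrite (Tr_unity_root _ p_prime prim3) //.
have two_neq0 := two_neq0_char3 char3.
rewrite !natrX (natr_mod3 p char3) p2 -[(2 %% 3)%N]/2%N exprS.
have M_neq0 : 2%:R ^+ m != 0 :> F by rewrite expf_neq0.
have [->|_] := eqVneq z 1; last first.
  by case: ifP => _; rewrite ?eqxx // eq_sym (negbTE M_neq0).
rewrite expr1n eqxx -subr_eq0 (_ : _ - _ = 2%:R ^+ m) ?(negbTE M_neq0) //.
by ring.
Qed.

(** * Weights of unions of lines *)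

Lemma predn_square (s : nat) : (0 < s)%N -> (s * s).-1 = (s.-1 * s.+1)%N.
Proof. by nia. Qed.

(** Below, F is a plane over its subfield K of order s, whose nonzero elements are
    the roots of t ^+ s.-1 = 1, and D is a union of lines of this plane, with the
    origin removed.  The parity of k and the invariance of A make D self-dual, in
    the sense of line_union_dual. *)
Section LineUnions.

Variables (F : finFieldType) (char3 : 3%N \in [pchar F]) (h : nat).
Hypothesis cardF : #|F| = (3 ^ (h.+1 + h.+1))%N.
Local Notation s := (3 ^ h.+1)%N.
Variables (k : nat) (A : pred F) (D : {set F}).
Hypotheses (k_even : ~~ odd k) (A_inv : forall z, A z^-1 = A z)
  (def_D : D = [set x | (x != 0) && A (x ^+ (s.-1 * k))]).

Let predn_cardF : #|F|.-1 = (s.-1 * s.+1)%N.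
Proof. by rewrite cardF expnD predn_square ?expn_gt0. Qed.

Let predn_s_gt0 : (0 < s.-1)%N.
Proof. by have := three_expn_gt1 h; case: s => [|[]]. Qed.

Lemma line_unionM (x t : F) : t ^+ s.-1 = 1 -> (x * t \in D) = (x \in D).
Proof.
move=> tU; have t_neq0 := neq0_expr_eq predn_s_gt0 (oner_neq0 F) tU.
rewrite def_D !inE mulf_eq0 (negbTE t_neq0) orbF.
by rewrite exprMn [t ^+ _]exprM tU expr1n mulr1.
Qed.

(** On the line where multiplication by b has relative trace 0, the value at b * x
    of the exponentiation that defines D is (-1) ^+ k = 1, so its values at x and
    at b are inverse to each other. *)
Lemma line_union_dual (b x : F) : (b * x) ^+ s.-1 = -1 -> (x \in D) = (b \in D).
Proof.
move=> bxN1; have : b * x != 0.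
  by apply: neq0_expr_eq predn_s_gt0 _ bxN1; rewrite oppr_eq0 oner_eq0.
rewrite mulf_eq0 negb_or => /andP[b_neq0 x_neq0].
rewrite def_D !inE b_neq0 x_neq0 /= -A_inv; congr A.
apply/esym/(mulIf (expf_neq0 (s.-1 * k) x_neq0)).
by rewrite mulVf ?expf_neq0 // -exprMn exprM bxN1 -signr_odd (negbTE k_even).
Qed.

Definition trace_weight (b : F) : nat :=
  #|[set x in D | frobenius_sum (h.+1 + h.+1) (b * x) != 0]|.

(** The solutions x form one whole line, which by line_union_dual lies in D if b
    does, and is disjoint from D otherwise. *)
Lemma card_fiber_dual (b : F) : b != 0 ->
  #|[set x in D | (b * x) ^+ s.-1 == -1]| = ((b \in D) * s.-1)%N.
Proof.
move=> b_neq0.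
have card_ker : #|[set x | (b * x) ^+ s.-1 == -1]| = s.-1.
  rewrite -[RHS](@card_expr_eqN1 F).
  - rewrite -(card_imset _ (mulfI b_neq0)); apply: eq_card => y; rewrite [RHS]inE.
    apply/imsetP/idP => [[x + ->]|yN1]; first by rewrite inE.
    by exists (b^-1 * y); rewrite ?inE mulVKf.
  - exact: predn_s_gt0.
  - rewrite predn_cardF mulnC dvdn_mul //.
    by rewrite dvdn2 /= oddX.
  - exact: two_neq0_char3.
have [b_in|b_out] := boolP (b \in D).
  rewrite mul1n -[RHS]card_ker; apply: eq_card => x; rewrite !inE.
  by apply: andb_idl => /eqP/line_union_dual ->.
apply/eqP; rewrite cards_eq0; apply/eqP/setP => x; rewrite !inE.
by apply/andP => -[xD /eqP/line_union_dual]; rewrite xD (negbTE b_out).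
Qed.

(** Averaging over the scalars t of K turns the weight into a sum, over the points
    x of D, of numbers of nonzero trace values on the line through b * x, which
    card_line_trace_neq0 gives. *)
Lemma trace_weightE (b : F) : b != 0 ->
  (s.-1 * trace_weight b = 2 * 3 ^ h * (#|D| - (b \in D) * s.-1))%N.
Proof.
move=> b_neq0.
pose U := [set t : F | t ^+ s.-1 == 1].
have cardU : #|U| = s.-1.
  apply: card_expr_eq1; first exact: predn_s_gt0.
  by rewrite predn_cardF dvdn_mulr.
have scale t : t \in U ->
    trace_weight b = (\sum_(x in D) (frobenius_sum (h.+1 + h.+1) (b * x * t) != 0)%R)%N.
  rewrite inE => /eqP tU; have t_neq0 := neq0_expr_eq predn_s_gt0 (oner_neq0 F) tU.
  rewrite /trace_weight -sum1_card big_mkcond (reindex_inj (mulIf t_neq0)) /=.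
  rewrite [RHS]big_mkcond; apply: eq_bigr => x _.
  by rewrite inE line_unionM // mulrA; case: (x \in D) => //=; case: ifP.
rewrite -{1}cardU -sum_nat_const (eq_bigr _ scale) exchange_big /=.
have line x : x \in D -> (\sum_(t in U) (frobenius_sum (h.+1 + h.+1) (b * x * t) != 0)%R)%N
    = if (b * x) ^+ s.-1 == -1 then 0%N else (2 * 3 ^ h)%N.
  rewrite def_D inE => /andP[x_neq0 _].
  rewrite -(card_line_trace_neq0 char3 cardF) ?mulf_neq0 // -sum1_card.
  rewrite [RHS]big_mkcond [LHS]big_mkcond; apply: eq_bigr => t _.
  by rewrite !inE; case: ifP => //= _; case: ifP.
rewrite (eq_bigr _ line) -card_fiber_dual //.
rewrite -(cardsID [set x | (b * x) ^+ s.-1 == -1] D).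
rewrite (_ : D :&: _ = [set x in D | (b * x) ^+ s.-1 == -1]); last first.
  by apply/setP => x; rewrite !inE.
rewrite addKn [RHS]mulnC -sum_nat_const big_mkcond [RHS]big_mkcond /=.
apply: eq_bigr => x _; rewrite !inE; case: (x \in D); rewrite ?andbF ?andbT //.
by case: eqP.
Qed.

Lemma trace_weight_gt0 (b : F) : (s.-1 < #|D|)%N -> b != 0 -> (0 < trace_weight b)%N.
Proof.
move=> D_gt b_neq0; have := trace_weightE b_neq0.
case: (trace_weight b) => // /esym/eqP; rewrite muln0 !muln_eq0 expn_eq0 /=.
rewrite subn_eq0 leqNgt (leq_ltn_trans _ D_gt) //.
by case: (b \in D); rewrite ?mul1n ?mul0n.
Qed.

End LineUnions.

(** * Two-weight codes from self-dual unions of lines *)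

Section Code.

Variables (F : finFieldType) (char3 : 3%N \in [pchar F]) (n : nat) (d : n.-tuple F).
Local Notation L := (pPrimeCharType char3).
Local Notation C := (defining_set_code char3 d).

Definition codeword (x : F) : 'rV['F_3]_n := \row_(j < n) Tr char3 (tnth d j * x).

Lemma codewordB : {morph codeword : x y / x - y}.
Proof. by move=> x y; apply/rowP => j; rewrite !mxE mulrBr TrB. Qed.

HB.instance Definition _ :=
  GRing.isZmodMorphism.Build F 'rV['F_3]_n codeword codewordB.

Lemma codeword_linear : linear (codeword : L -> 'rV['F_3]_n).
Proof.
move=> a x y; rewrite [LHS](raddfD codeword); congr (_ + _).
rewrite -[a in LHS]natr_Zp -[a in RHS]natr_Zp !scaler_nat.
exact: (raddfMn codeword).
Qed.

(** The copy of codeword that has the vector space structure of F over 'F_3 on its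
    domain, as needed to speak of its image as a subspace. *)
Definition codewordL : L -> 'rV['F_3]_n := codeword.

HB.instance Definition _ :=
  GRing.isLinear.Build 'F_3 L 'rV['F_3]_n _ codewordL codeword_linear.

Lemma linear_code_of_dim_codeword (f : nat) : #|F| = (3 ^ f)%N ->
  injective codeword -> linear_code_of_dim f C.
Proof.
move=> cardF cw_inj.
pose V := limg (linfun codewordL).
have CV : C =i V.
  move=> c; apply/imsetP/memv_imgP => [[x _ ->]|[x _ ->]]; exists x; rewrite ?memvf //.
    by rewrite lfunE.
  by rewrite lfunE.
exists V => //; apply/eqP; rewrite -(eqn_exp2l _ _ (isT : 1 < 3)%N) -cardF.
rewrite -{1}(card_Fp (isT : prime 3)) -(@card_vspace _ _ (Vector.class 'rV['F_3]_n)).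
by rewrite -(eq_card CV) card_imset.
Qed.

Lemma hamming_weight_codeword (f : nat) (b : F) : #|F| = (3 ^ f)%N -> uniq d ->
  hamming_weight (codeword b) = #|[set x in d | frobenius_sum f (b * x) != 0]|.
Proof.
move=> cardF uniq_d; rewrite /hamming_weight.
have d_inj : injective (tnth d) by apply/tuple_uniqP.
rewrite -(card_imset _ d_inj); apply: eq_card => x; rewrite inE.
apply/imsetP/andP => [[j + ->]|[/tnthP[j ->] Tj]].
  by rewrite inE mxE (Tr_eq0 _ _ cardF) mem_tnth mulrC.
by exists j; rewrite // inE mxE (Tr_eq0 _ _ cardF) mulrC.
Qed.

Lemma weight_count_codeword (R : rcfType) (w : R) : injective codeword ->
  weight_count C w = #|[set b | (hamming_weight (codeword b))%:R == w]|.
Proof.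
move=> cw_inj; rewrite /weight_count -[RHS](card_imset _ cw_inj); apply: eq_card => c.
rewrite !inE; apply/andP/imsetP => [[/imsetP[b _ ->] wb]|[b + ->]].
  by exists b; rewrite ?inE.
by rewrite inE => wb; split=> //; apply/imsetP; exists b.
Qed.

End Code.

(** The lower bound on n, which says that D has more than one line, makes every
    weight positive, hence the map from F to the code injective; the upper bound
    makes both weights occur. *)
Lemma two_weight_code (R : rcfType) (F : finFieldType) (char3 : 3%N \in [pchar F])
    (h k n : nat) (A : pred F) (d : n.-tuple F) (w1 w2 : R) :
  let s := (3 ^ h.+1)%N in let S : R := s%:R in
  let C := defining_set_code char3 d in
  #|F| = (3 ^ (h.+1 + h.+1))%N -> ~~ odd k -> (forall z, A z^-1 = A z) ->
  uniq d -> d =i [set x | (x != 0) && A (x ^+ (s.-1 * k))] ->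
  (s.-1 < n < #|F|.-1)%N ->
  w2 = 2 * S * n%:R / (3 * (S - 1)) -> w1 = w2 - 2 * S / 3 ->
  [/\ linear_code_of_dim (h.+1 + h.+1) C, has_two_weights C w1 w2,
      weight_count C w1 = n & weight_count C w2 = (#|F|.-1 - n)%N].
Proof.
move=> s S C cardF k_even A_inv uniq_d d_D /andP[n_gt n_lt] w2E w1E.
set D := [set x | _] in d_D.
have cardD : #|D| = n by rewrite -(eq_card d_D) (card_uniqP uniq_d) size_tuple.
have s_gt1 : (1 < s)%N := three_expn_gt1 h.
have S_gt1 : 1 < S by rewrite ltr1n.
have SE : S = 3 * (3 ^ h)%:R by rewrite /S /s expnS natrM.
have wtE b : hamming_weight (codeword char3 d b) = trace_weight h D b.
  rewrite (hamming_weight_codeword _ _ cardF) //; apply: eq_card => x.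
  by rewrite !inE d_D inE.
have wE b : b != 0 -> (hamming_weight (codeword char3 d b))%:R
    = if b \in D then w1 else w2 :> R.
  move=> b_neq0; rewrite wtE.
  have /(congr1 (fun i => i%:R : R)) :=
    trace_weightE char3 cardF k_even A_inv (erefl D) b_neq0.
  rewrite -/s !natrM cardD natrB; last by case: (b \in D); rewrite ?mul1n ?mul0n // ltnW.
  have -> : s.-1%:R = S - 1 by rewrite -subn1 natrB // ltnW.
  have -> : (3 ^ h)%:R = S / 3 :> R by rewrite SE; field.
  move=> eq_w; apply: (@mulfI _ (S - 1)); first by rewrite subr_eq0 gt_eqF.
  rewrite eq_w natrM -subn1 natrB ?(ltnW s_gt1) // -/S w1E w2E.
  have S1_neq0 : S - 1 != 0 by rewrite subr_eq0 gt_eqF.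
  by case: (b \in D) => /=; field.
have wt0 : hamming_weight (codeword char3 d 0) = 0%N.
  apply/eqP; rewrite cards_eq0; apply/eqP/setP => j; rewrite !inE.
  by rewrite (raddf0 (codeword char3 d)) mxE eqxx.
have wt_gt0 b : b != 0 -> (0 < hamming_weight (codeword char3 d b))%N.
  by move=> b_neq0; rewrite wtE (trace_weight_gt0 char3 cardF k_even A_inv) // cardD.
have cw_inj : injective (codeword char3 d).
  move=> x y xy; apply/eqP; rewrite -subr_eq0; apply/negPn/negP => /wt_gt0.
  by rewrite codewordB xy -codewordB subrr wt0.
have D0 : 0 \notin D by rewrite inE eqxx.
have [b1 b1D] : exists b, b \in D.
  by apply/set0Pn; rewrite -card_gt0 cardD (leq_ltn_trans _ n_gt).
have b1_neq0 : b1 != 0 by apply: contraNneq D0 => <-.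
have card_out : #|[set b | (b != 0) && (b \notin D)]| = (#|F|.-1 - n)%N.
  rewrite -cardD -(cardC1 (0 : F)) -(cardsE (predC1 0)) -cardsDS; last first.
    by apply/subsetP => x xD; rewrite !inE; apply: contraNneq D0 => <-.
  by apply: eq_card => x; rewrite !inE andbC.
have [b2] : exists b, b \in [set b | (b != 0) && (b \notin D)].
  by apply/set0Pn; rewrite -card_gt0 card_out subn_gt0.
rewrite inE => /andP[b2_neq0 b2D].
have w1_neq_w2 : w1 != w2.
  by rewrite w1E -subr_eq0; apply/eqP; lra.
have w_neq0 b : b != 0 -> (if b \in D then w1 else w2) != 0.
  by move=> b_neq0; rewrite -wE // pnatr_eq0 -lt0n wt_gt0.
split.
- exact: linear_code_of_dim_codeword.
- move=> w; split=> [[c [/imsetP[b _ ->] cw_neq0 <-]]|].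
    rewrite wE; first by case: ifP; [left|right].
    apply: contraNneq cw_neq0 => ->.
    by rewrite -/(codeword char3 d 0) (raddf0 (codeword char3 d)).
  have cw_neq0 b : b != 0 -> codeword char3 d b != 0.
    apply: contra_neq => cwb0; apply: cw_inj.
    by rewrite cwb0 (raddf0 (codeword char3 d)).
  case=> ->.
    exists (codeword char3 d b1); rewrite cw_neq0 ?wE ?b1D //; split=> //.
    exact: imset_f.
  exists (codeword char3 d b2); rewrite cw_neq0 ?wE ?(negbTE b2D) //; split=> //.
  exact: imset_f.
- rewrite weight_count_codeword // -[RHS]cardD; apply: eq_card => b; rewrite [LHS]inE.
  have [->|b_neq0] := eqVneq b 0.
    by rewrite wt0 (negbTE D0) eq_sym; have := w_neq0 _ b1_neq0; rewrite b1D => /negbTE.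
  by rewrite wE //; case: (b \in D); rewrite ?eqxx // eq_sym (negbTE w1_neq_w2).
- rewrite weight_count_codeword // -card_out; apply: eq_card => b; rewrite !inE.
  have [->|b_neq0] := eqVneq b 0.
    by rewrite wt0 eq_sym; have := w_neq0 _ b2_neq0; rewrite (negbTE b2D) => /negbTE.
  rewrite wE // -/(b \in D).
  by rewrite [b \in D]inE b_neq0 /=; case: ifP; rewrite ?eqxx // (negbTE w1_neq_w2).
Qed.

(** * Parameters of the code of a primitive root *)

Theorem theorem4p1 (R : rcfType) (m p q : nat)
    (m_gt0 : (0 < m)%N) (p_prime : prime p) (p_odd : odd p)
    (prim3 : primitive_root_mod 3 (p ^ m))
    (def_q : q = (3 ^ totient (p ^ m))%N)
    (F : finFieldType) (char3 : 3%N \in [pchar F]) (cardF : #|F| = q)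
    (n : nat) (d : n.-tuple F) (uniq_d : uniq d)
    (def_D : d =i [set x : F | (x != 0) && (Tr char3 (x ^+ (q.-1 %/ p ^ m)) == 0)]) :
  let C : {set 'rV['F_3]_n} := defining_set_code char3 d in
  let P : R := p%:R in
  let Q : R := q%:R in
  (p = 1 %[mod 3] ->
    let w1 : R := 2 * (P ^+ m - P + 1) * Q / (3 * P ^+ m)
                  - 2 * (P - 1) * Num.sqrt Q / (3 * P ^+ m) in
    let w2 : R := 2 * (P ^+ m - P + 1) * Q / (3 * P ^+ m)
                  + 2 * (P ^+ m - P + 1) * Num.sqrt Q / (3 * P ^+ m) in
    [/\ n%:R = (Q - 1) * (P ^+ m - P + 1) / P ^+ m,
        linear_code_of_dim ((p - 1) * p ^ (m - 1)) C,
        has_two_weights C w1 w2,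
        (weight_count C w1)%:R = (P ^+ m - P + 1) * (Q - 1) / P ^+ m
      & (weight_count C w2)%:R = (P - 1) * (Q - 1) / P ^+ m])
  /\
  (p = 2 %[mod 3] -> (2 <= m)%N ->
    let w1 : R := 2 * (P ^+ (m - 1) - 1) * Q / (3 * P ^+ (m - 1))
                  + 2 * (P ^+ (m - 1) - 1) * Num.sqrt Q / (3 * P ^+ (m - 1)) in
    let w2 : R := 2 * (P ^+ (m - 1) - 1) * Q / (3 * P ^+ (m - 1))
                  - 2 * Num.sqrt Q / (3 * P ^+ (m - 1)) in
    [/\ n%:R = (Q - 1) * (P ^+ (m - 1) - 1) / P ^+ (m - 1),
        linear_code_of_dim ((p - 1) * p ^ (m - 1)) C,
        has_two_weights C w1 w2,
        (weight_count C w1)%:R = (Q - 1) / P ^+ (m - 1)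
      & (weight_count C w2)%:R = (P ^+ (m - 1) - 1) * (Q - 1) / P ^+ (m - 1)]).
Proof.
move=> C P Q.
case: m m_gt0 prim3 def_q def_D => // m _; set N := (p ^ m.+1)%N => prim3 def_q def_D.
rewrite (_ : m.+1 - 1 = m)%N; last by rewrite subn1.
have p_gt1 := prime_gt1 p_prime.
have totE : totient N = ((p - 1) * p ^ m)%N by rewrite totient_pfactor // subn1.
have [h toth] : exists h, totient N = (h.+1 + h.+1)%N.
  have : ~~ odd (totient N) by rewrite totE oddM oddB ?(ltnW p_gt1) // p_odd.
  have : (0 < totient N)%N by rewrite totient_gt0 expn_gt0 (ltnW p_gt1).
  move=> tot_gt0 /even_halfK; rewrite -addnn.
  by case: (totient N)./2 => [t0|h <-]; [rewrite -t0 in tot_gt0 | exists h].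
rewrite -totE toth.
have /dvdnP[k kN] : (N %| (3 ^ h.+1).+1)%N by exact: dvdn_primitive_root_half.
have k_even : ~~ odd k.
  have : ~~ odd (3 ^ h.+1).+1 by rewrite /= oddX.
  by rewrite kN oddM oddX p_odd orbT andbT.
(* Hence the fibers of x |-> x ^+ (s.-1 * k) consist of more than one line. *)
have k_gt1 : (1 < k)%N by case: (k) kN k_even => [|[]].
have cardF' : #|F| = (3 ^ (h.+1 + h.+1))%N by rewrite cardF def_q toth.
have q1E : q.-1 = ((3 ^ h.+1).-1 * (3 ^ h.+1).+1)%N.
  by rewrite -cardF cardF' expnD predn_square ?expn_gt0.
have s_gt1 := three_expn_gt1 h.
have N_gt0 : (0 < N)%N by rewrite expn_gt0 (ltnW p_gt1).
have NE : N = (p * p ^ m)%N by rewrite /N expnS.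
set s := (3 ^ h.+1)%N in kN q1E s_gt1.
(* The exponent that defines D, in the form used for unions of lines. *)
set e := (s.-1 * k)%N.
have eN : (e * N)%N = q.-1 by rewrite q1E kN mulnA.
have eE : (q.-1 %/ N)%N = e by rewrite -eN mulnK.
rewrite eE in def_D.
have e_gt0 : (0 < e)%N by rewrite muln_gt0 -ltnS prednK ?(ltnW s_gt1) // s_gt1 ltnW.
have e_dvd : (e %| #|F|.-1)%N by rewrite cardF -eN dvdn_mulr.
have ep_dvd : (e * p %| #|F|.-1)%N by rewrite cardF -eN dvdn_pmul2l // NE dvdn_mulr.
have xeN (x : F) : x != 0 -> (x ^+ e) ^+ N = 1.
  move=> x_neq0; apply: (mulfI x_neq0).
  by rewrite mulr1 -exprM eN -exprS -cardF prednK ?expf_card // cardF' expn_gt0.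
have cardep : #|[set x : F | x ^+ (e * p) == 1]| = (e * p)%N.
  by apply: card_expr_eq1 => //; rewrite muln_gt0 e_gt0 ltnW.
have carde : #|[set x : F | x ^+ e == 1]| = e by exact: card_expr_eq1.
have sub_e : [set x : F | x ^+ e == 1] \subset [set x : F | x ^+ (e * p) == 1].
  by apply/subsetP => x; rewrite !inE exprM => /eqP ->; rewrite expr1n.
have sub_ep : [set x : F | x ^+ (e * p) == 1] \subset [set~ 0].
  apply/subsetP => x; rewrite !inE; apply: contraTneq => ->.
  by rewrite expr0n muln_eq0 !eqn0Ngt e_gt0 (ltnW p_gt1) /= eq_sym oner_eq0.
have cardF1 : #|[set~ (0 : F)]| = q.-1 by rewrite cardsC1 cardF.
have cardn : #|d| = n by rewrite (card_uniqP uniq_d) size_tuple.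
pose S : R := s%:R; pose K : R := k%:R.
have QE : Q = S ^+ 2 by rewrite /Q def_q toth expnD natrM expr2.
have sqrtQ : Num.sqrt Q = S by rewrite QE sqrtr_sqr ger0_norm ?ler0n.
have PN : P ^+ m.+1 = N%:R by rewrite natrX.
have S_gt1 : 1 < S by rewrite ltr1n.
have SE : S + 1 = K * P ^+ m.+1 by rewrite PN -natrM -kN -addn1 natrD.
have P_neq0 : P != 0 by rewrite pnatr_eq0 -lt0n ltnW.
have S1_neq0 : S - 1 != 0 by rewrite subr_eq0 gt_eqF.
have s1E : s.-1%:R = S - 1 by rewrite -subn1 natrB // ltnW.
have q1R : q.-1%:R = (S - 1) * (S + 1) by rewrite q1E natrM s1E -addn1 natrD.
have eR : e%:R = (S - 1) * K by rewrite natrM s1E.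
have M_neq0 : P ^+ m != 0 by rewrite expf_neq0.
have QR : Q - 1 = (S - 1) * (K * P ^+ m.+1) by rewrite -SE QE; ring.
have PN_neq0 : P ^+ m.+1 != 0 by rewrite expf_neq0.
have lt_se : (s.-1 < e)%N by rewrite ltn_Pmulr // -ltnS prednK // ltnW.
have le_ep : (e * p <= e * N)%N by rewrite leq_mul2l NE leq_pmulr ?orbT // expn_gt0 ltnW.
have lt_ep : (e < e * p)%N by rewrite ltn_Pmulr.
split=> [p1 w1 w2|p2 m_gt1 w1 w2].
- pose A (z : F) := (z == 1) || (z ^+ p != 1).
  have A_inv z : A z^-1 = A z by rewrite /A exprVn !invr_eq1.
  have d_D : d =i [set x | (x != 0) && A (x ^+ e)].
    move=> x; rewrite def_D !inE; apply: andb_id2l => x_neq0.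
    by rewrite (Tr_unity_root_mod1 _ p_prime prim3) // ?xeN // cardF def_q.
  have card_diff :
      #|[set x : F | x ^+ (e * p) == 1] :\: [set x | x ^+ e == 1]| = (e * p - e)%N.
    by rewrite cardsDS // cardep carde.
  have nE : n = (q.-1 - (e * p - e))%N.
    rewrite -card_diff -cardF1 -cardsDS ?(subset_trans (subsetDl _ _)) //.
    rewrite -cardn (eq_card d_D); apply: eq_card => x.
    by rewrite !inE /A -exprM negb_and negbK andbC.
  have le_e : (e * p - e <= q.-1)%N.
    by rewrite -card_diff -cardF1 subset_leq_card // (subset_trans (subsetDl _ _)).
  have nR : n%:R = (S - 1) * K * (P ^+ m.+1 - P + 1).
    rewrite nE natrB // natrB ?leq_pmulr ?(ltnW p_gt1) // natrM eR q1R SE; ring.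
  have n_bounds : (s.-1 < n < #|F|.-1)%N.
    rewrite cardF nE -eN; move: lt_se le_ep lt_ep; clear.
    by move: e s.-1 (e * p)%N (e * N)%N; lia.
  have w2E : w2 = 2 * S * n%:R / (3 * (S - 1)).
    rewrite /w2 nR sqrtQ QE.
    transitivity (2 * S * (S + 1) * (P ^+ m.+1 - P + 1) / (3 * P ^+ m.+1)); first by field.
    by rewrite SE; field; apply/andP.
  have w1E : w1 = w2 - 2 * S / 3.
    by rewrite /w1 /w2 sqrtQ; field.
  have [dimC twoC c1 c2] :=
    two_weight_code char3 cardF' k_even A_inv uniq_d d_D n_bounds w2E w1E.
  split=> //.
  + by rewrite nR QR; field.
  + by rewrite c1 nR QR; field.
  + rewrite c2 natrB; last by rewrite ltnW //; case/andP: n_bounds.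
    by rewrite cardF q1R nR QR SE; field.
- pose A (z : F) := z ^+ p != 1.
  have A_inv z : A z^-1 = A z by rewrite /A exprVn invr_eq1.
  have d_D : d =i [set x | (x != 0) && A (x ^+ e)].
    move=> x; rewrite def_D !inE; apply: andb_id2l => x_neq0.
    by rewrite (Tr_unity_root_mod2 _ p_prime prim3) // ?xeN // cardF def_q.
  have nE : n = (q.-1 - e * p)%N.
    rewrite -cardep -cardF1 -cardsDS // -cardn (eq_card d_D).
    by apply: eq_card => x; rewrite !inE /A -exprM andbC.
  have nR : n%:R = (S - 1) * K * P * (P ^+ m - 1).
    rewrite nE natrB; last by rewrite -eN.
    by rewrite natrM eR q1R SE exprS; ring.
  have n_bounds : (s.-1 < n < #|F|.-1)%N.
    have p2_le : (p * 2 <= N)%N.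
      by rewrite NE leq_mul2l (leq_trans p_gt1) ?orbT // -{1}(expn1 p) leq_pexp2l // ltnW.
    have : (e * (p * 2) <= e * N)%N by rewrite leq_mul2l p2_le orbT.
    rewrite mulnA cardF nE -eN; move: lt_se le_ep lt_ep; clear.
    by move: e s.-1 (e * p)%N (e * N)%N; lia.
  have w1E : w1 = 2 * S * n%:R / (3 * (S - 1)).
    rewrite /w1 nR sqrtQ QE.
    transitivity (2 * S * (S + 1) * (P ^+ m - 1) / (3 * P ^+ m)); first by field.
    by rewrite SE exprS; field; apply/andP.
  have w2E : w2 = w1 - 2 * S / 3.
    by rewrite /w1 /w2 sqrtQ; field.
  have [dimC twoC c2 c1] :=
    two_weight_code char3 cardF' k_even A_inv uniq_d d_D n_bounds w1E w2E.
  split=> //.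
  + by rewrite nR QR exprS; field.
  (* Here the codewords of the elements of D have the second weight. *)
  + by move=> w; rewrite twoC; split=> -[]; [right|left|right|left].
  + rewrite c1 natrB; last by rewrite ltnW //; case/andP: n_bounds.
    by rewrite cardF q1R nR QR SE exprS; field.
  + by rewrite c2 nR QR exprS; field.
Qed.
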